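(* Let $\Delta t>0$, $n\ge 0$, and let $u_h^n,u_h^{n-1}\in V_h$ (with $u_h^{-1}:=u_h^0$ if $n=0$), $q_h^n\in V_h$ with $(q_h^n,\psi)=A(u_h^n,\psi)$ for all $\psi\in V_h$, and $r^n\in\mathbb{R}$ be given. Put $u_h^{n,*}=\frac32u_h^n-\frac12u_h^{n-1}$ and $v^{n+1/2}=(v^n+v^{n+1})/2$ for $v=u_h,q_h,r$. Consider one step of the second order SAV-DG scheme: find $(u_h^{n+1},q_h^{n+1},r^{n+1})\in V_h\times V_h\times\mathbb{R}$ such that for all $\phi,\psi\in V_h$, $$(D_tu_h^n,\phi)=-A(q_h^{n+1/2},\phi)-r^{n+1/2}(b(u_h^{n,*}),\phi),\qquad (q_h^{n+1},\psi)=A(u_h^{n+1},\psi),\qquad D_tr^n=\frac12\int_\Omega b(u_h^{n,*})\,D_tu_h^n\,dx .$$ This step can be realized in two steps, i.e. its solution is exactly the one obtained as follows. (i) Determine $r^{n+1/2}$ (equivalently $r^{n+1}=2r^{n+1/2}-r^n$) by $$r^{n+1/2}=r^n-\frac12(\Pi b(u_h^{n,*}),u_h^n)+\frac12R^{n,*},$$ where $$R^{n,*}=\frac{\left(b(u_h^{n,*}),\mathcal{B}_h(\Delta t/2)\xi^{n,*}\right)}{1+\frac{\Delta t}{4}\left(\Pi b(u_h^{n,*}),\mathcal{B}_h(\Delta t/2)\Pi b(u_h^{n,*})\right)},\qquad \xi^{n,*}=u_h^n-\frac12\Delta t\,r^n\,\Pi b(u_h^{n,*})+\frac{\Delta t}{4}\left(b(u_h^{n,*}),u_h^n\right)\Pi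 b(u_h^{n,*}).$$ (ii) With this $r^{n+1/2}$, solve the linear system for $(u_h^{n+1},q_h^{n+1})\in V_h\times V_h$: for all $\phi,\psi\in V_h$, $$(D_tu_h^n,\phi)=-A(q_h^{n+1/2},\phi)-(b(u_h^{n,*}),\phi)\,r^{n+1/2},\qquad (q_h^{n+1},\psi)=A(u_h^{n+1},\psi).$$
   Context: $\Omega\subset\mathbb{R}^d$ is a convex bounded domain, partitioned by a shape regular mesh $\mathcal{T}_h=\{K\}$; $k$ is a fixed polynomial degree and $V_h=\{v\in L^2(\Omega): v|_K\in P^k(K)\ \forall K\in\mathcal{T}_h\}$, where $P^k(K)$ is the set of polynomials of degree at most $k$ on $K$. $(\cdot,\cdot)$ and $\|\cdot\|$ are the $L^2(\Omega)$ inner product and norm. $\Gamma^0$ is the set of interior interfaces and $\Gamma^\partial$ the set of boundary faces. On an interface $e\subset\partial K_1\cap\partial K_2$ with unit normal $\nu$ oriented from $K_1$ to $K_2$, $\{v\}=\frac12(v|_{\partial K_1}+v|_{\partial K_2})$ and $[v]=v|_{\partial K_2}-v|_{\partial K_1}$, where $v|_{\partial K_i}$ is the trace on $e$ taken from $K_i$. With a real parameter $a$, the bilinear form on $V_h\times V_h$ is $A(w,v)=A^0(w,v)+A^b(w,v)$, $$A^0(w,v)=\sum_{K\in\mathcal{T}_h}\int_K\left(\nabla w\cdot\nabla v-\frac a2wv\right)dx+\sum_{e\in\Gamma^0}\int_e\left(\{\partial_\nu w\}[v]+[w]\{\partial_\nu v\}\right)ds .$$ One of two boundary conditions is fixed: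 (periodic case) $A^b(w,v)=\frac12\int_{\Gamma^\partial}(\{\partial_\nu w\}[v]+[w]\{\partial_\nu v\})\,ds$, where opposite boundary faces are identified so that each such face has two neighbouring elements (the factor $\frac12$ avoids double counting); or (case $\partial_{\mathbf n}u=\partial_{\mathbf n}\Delta u=0$ on $\partial\Omega$) $A^b(w,v)=0$. $\Phi:\mathbb{R}\to\mathbb{R}$ is a (nonlinear) continuously differentiable function, and $B$ is a constant such that $\int_\Omega\Phi(v(x))\,dx+B>0$ for all $v\in V_h$. For such $w$, $$b(w)=\frac{\Phi'(w)}{\sqrt{\int_\Omega\Phi(w(x))\,dx+B}} .$$ $\Pi$ is the $L^2$ projection onto $V_h$: $(\Pi w,\phi)=(w,\phi)$ for all $\phi\in V_h$. $D_tv^n=\frac{v^{n+1}-v^n}{\Delta t}$. The operator $\mathcal{L}_h:V_h\to V_h$ is defined by $(\mathcal{L}_hv,\psi)=A(v,\psi)$ for all $\psi\in V_h$. For $\tau>0$, $\mathcal{B}_h(\tau):V_h\to V_h$ is the operator $\mathcal{B}_h(\tau)=(I+\tau\mathcal{L}_h^2)^{-1}$; equivalently $v_h=\mathcal{B}_h(\tau)f_h$ is the first component of the unique solution $(v_h,w_h)\in V_h\times V_h$ of $\tau A(w_h,\phi)+(v_h,\phi)=(f_h,\phi)$, $(w_h,\psi)=A(v_h,\psi)$ for all $\phi,\psi\in V_h$. *)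

(* Defs.v *)
From HB Require Import structures.
From mathcomp Require Import all_boot all_order all_algebra.
From mathcomp Require Import all_classical all_reals all_analysis.
(* The notations of mpoly clash with those of mathcomp-analysis, so only its
   structure instances are imported and its constants are used qualified. *)
From mathcomp Require Import (canonicals, coercions) mpoly.

Set Implicit Arguments.
Unset Strict Implicit.
Unset Printing Implicit Defensive.

Import Order.TTheory GRing.Theory Num.Theory numFieldNormedType.Exports.

Local Open Scope classical_set_scope.
Local Open Scope ring_scope.

(* ------------------------------------------------------------------ *)
(* Lebesgue measure on R^n, as the iterated product of [lebesgue_measure] on
   the measurable space of n-tuples.                                    *)

Section LebesgueTupleStep.
Context {R : realType} (n : nat).
Local Notation RT := (measurableTypeR R).
Variable mu : {sigma_finite_measure set (n.-tuple RT) -> \bar R}.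

Let consp (p : RT * n.-tuple RT) : n.+1.-tuple RT := [tuple of p.1 :: p.2].
Let unconsp (t : n.+1.-tuple RT) : RT * n.-tuple RT :=
  (tnth t ord0, [tuple of behead t]).

Let measurable_consp : measurable_fun [set: RT * n.-tuple RT] consp.
Proof. exact: measurable_cons measurable_fst measurable_snd. Qed.

Let measurable_unconsp : measurable_fun [set: n.+1.-tuple RT] unconsp.
Proof. by apply: measurable_fun_pair; [exact: measurable_tnth|exact: measurable_behead]. Qed.

Let conspK : cancel consp unconsp.
Proof. by case=> x t; congr pair; exact/val_inj. Qed.

Let unconspK : cancel unconsp consp.
Proof. by move=> t; rewrite [RHS]tuple_eta. Qed.

Definition lebesgue_cons : set (n.+1.-tuple RT) -> \bar R :=
  pushforward (lebesgue_measure \x mu)%E consp.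

Let lebesgue_cons0 : lebesgue_cons set0 = 0%E.
Proof. by rewrite /lebesgue_cons /pushforward preimage_set0 measure0. Qed.

Let lebesgue_cons_ge0 A : (0 <= lebesgue_cons A)%E.
Proof. exact: measure_ge0. Qed.

Let lebesgue_cons_sigma_additive : semi_sigma_additive lebesgue_cons.
Proof.
exact: (@measure_semi_sigma_additive _ _ _
  (measure_function_pushforward__canonical__measure_function_Measure
     (lebesgue_measure \x mu)%E measurable_consp)).
Qed.

HB.instance Definition _ := isMeasure.Build _ _ _ lebesgue_cons
  lebesgue_cons0 lebesgue_cons_ge0 lebesgue_cons_sigma_additive.

Let lebesgue_cons_sigma_finite : sigma_finite setT lebesgue_cons.
Proof.
have /sigma_finiteP[F [FT ndF Foo]] := sigma_finiteT (@lebesgue_measure R).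
have /sigma_finiteP[G [GT ndG Goo]] := sigma_finiteT mu.
exists (fun i => unconsp @^-1` (F i `*` G i)) => [|i].
  apply/esym; rewrite -subTset => t _.
  have [i _ Fi] : (\bigcup_i F i) (unconsp t).1 by rewrite -FT.
  have [j _ Gj] : (\bigcup_i G i) (unconsp t).2 by rewrite -GT.
  exists (maxn i j) => //; split.
    by move/subsetPset: (ndF _ _ (leq_maxl i j)); exact.
  by move/subsetPset: (ndG _ _ (leq_maxr i j)); exact.
have [mF Fi] := Foo i; have [mG Gi] := Goo i; split.
  rewrite -[X in measurable X]setTI; apply: measurable_unconsp => //.
  exact: measurableX.
rewrite /lebesgue_cons /pushforward -comp_preimage.
rewrite (_ : unconsp \o consp = id) ?preimage_id; last exact/funext/conspK.
rewrite product_measure1E// lte_mul_pinfty// ge0_fin_numE//.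
Qed.

HB.instance Definition _ := Measure_isSigmaFinite.Build _ _ _ lebesgue_cons
  lebesgue_cons_sigma_finite.

End LebesgueTupleStep.

Fixpoint lebesgue_tuple (R : realType) (n : nat) :
    {sigma_finite_measure set (n.-tuple (measurableTypeR R)) -> \bar R} :=
  match n with
  | 0 => \d_[tuple]
  | n'.+1 => lebesgue_cons (lebesgue_tuple R n')
  end.

Section Geometry.
Context {R : realType} {d : nat}.
Local Notation pt := 'rV[R]_d.

Definition dot (x y : pt) : R := \sum_(i < d) x ord0 i * y ord0 i.
Definition enorm (x : pt) : R := Num.sqrt (dot x x).

Definition vol_int (E : set pt) (f : pt -> R) : R :=
  let pt_of (t : d.-tuple (measurableTypeR R)) : pt := \row_i tnth t i in
  \int[lebesgue_tuple R d]_(t in [set t | E (pt_of t)]) f (pt_of t).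

(* Integral over a subset E of the hyperplane [dot nu x = c] (nu a unit vector)
   for the (d-1)-dimensional surface measure: since Lebesgue measure on R^d is
   the product of that of the hyperplane and that of the normal direction, it is
   the volume integral of the function extended constantly along nu over the
   prism of height 1 with base E. *)
Definition surf_int (nu : pt) (c : R) (E : set pt) (f : pt -> R) : R :=
  let height x := dot nu x - c in
  let foot x := x - height x *: nu in
  vol_int [set x | 0 <= height x <= 1 /\ E (foot x)] (f \o foot).

(* E has nonempty relative interior in the hyperplane [dot nu x = c] *)
Definition flat_full (nu : pt) (c : R) (E : set pt) : Prop :=
  exists x r, [/\ dot nu x = c, 0 < r &
    forall y, dot nu y = c -> enorm (y - x) < r -> E y].

Definition convex_bounded_domain (Omega : set pt) : Prop :=
  [/\ open Omega, Omega !=set0, convex_set Omega & bounded_set Omega].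

Definition boundary (Omega : set pt) : set pt := closure Omega `\` Omega°.

(* A convex polytope: normal are the outward unit normals of its faces. *)
Record cell := Cell {
  nface : nat;
  normal : 'I_nface -> pt;
  offset : 'I_nface -> R }.

Definition cell_open (K : cell) : set pt :=
  [set x | forall i : 'I_(nface K), dot (normal i) x < offset i].
Definition cell_closed (K : cell) : set pt :=
  [set x | forall i : 'I_(nface K), dot (normal i) x <= offset i].
Definition face (K : cell) (i : 'I_(nface K)) : set pt :=
  [set x | cell_closed K x /\ dot (normal i) x = offset i].

Definition is_cell (K : cell) : Prop :=
  [/\ forall i : 'I_(nface K), enorm (normal i) = 1, injective (@normal K),
      cell_open K !=set0 & bounded_set (cell_closed K)].

Definition is_mesh N (Omega : set pt) (T : 'I_N -> cell) : Prop :=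
  [/\ forall K, is_cell (T K),
      forall K, cell_open (T K) `<=` Omega,
      forall K L, K != L -> cell_open (T K) `&` cell_open (T L) = set0 &
      closure Omega = \bigcup_K cell_closed (T K)].

(* The diameter of each element is at most sigma times the radius of some ball
   inscribed in it. *)
Definition shape_regular (sigma : R) N (T : 'I_N -> cell) : Prop :=
  forall K, exists x rho, [/\ 0 < rho,
    forall y, enorm (y - x) < rho -> cell_open (T K) y &
    forall y z, cell_closed (T K) y -> cell_closed (T K) z ->
      enorm (y - z) <= sigma * rho].

Definition boundary_face (Omega : set pt) (K : cell) (i : 'I_(nface K)) : Prop :=
  face i `<=` boundary Omega /\ flat_full (normal i) (offset i) (face i).

(* [Periodic t]: the part of the boundary with outward normal nu is identified
   with the opposite one, of outward normal - nu, by the translation of vector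
   [t nu].
   [NoFlux]: the conditions d_n u = d_n (Delta u) = 0. *)
Inductive bcond := Periodic of (pt -> pt) | NoFlux.

Definition extreme_face (Omega : set pt) (nu : pt) : set pt :=
  [set x | closure Omega x /\ forall y, closure Omega y -> dot nu y <= dot nu x].

Definition bcond_ok N (Omega : set pt) (T : 'I_N -> cell) (bc : bcond) : Prop :=
  match bc with
  | Periodic t => forall K (i : 'I_(nface (T K))), boundary_face Omega i ->
      let nu := normal i in
      (fun x => x + t nu) @` extreme_face Omega nu = extreme_face Omega (- nu)
      /\ t (- nu) = - t nu
  | NoFlux => True
  end.

End Geometry.
Arguments cell : clear implicits.
Arguments bcond : clear implicits.
Arguments NoFlux {R d}.

Section DG.
Context {R : realType} {d N : nat}.
Local Notation pt := 'rV[R]_d.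
Local Notation poly := (mpoly.mpoly d R).

(* A piecewise polynomial function is given by its restrictions to the elements;
   a polynomial is determined by its values on an element, and L^2 does not see
   the values on the element boundaries. *)
Local Notation pw := {ffun 'I_N -> poly}.

Variables (Omega : set pt) (T : 'I_N -> cell R d) (k : nat).

Definition Vh : set pw := [set v | forall K, (mpoly.msize (v K) <= k.+1)%N].

Definition pev (p : poly) (x : pt) : R := mpoly.meval (x ord0) p.

Definition fn (v : pw) (x : pt) : R :=
  \sum_(K < N) \1_(cell_open (T K)) x * pev (v K) x.

Definition L2ip (f g : pt -> R) : R := vol_int Omega (fun x => f x * g x).

Definition grad (p : poly) (x : pt) : pt := \row_i pev (mpoly.mderiv i p) x.

(* int_E ({d_nu w}[v] + [w]{d_nu v}) ds for E in the hyperplane [dot nu x = c],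
   between the elements K1 and K2, nu pointing from K1 to K2; the traces from K2
   are taken at the points translated by t, t = 0 at an interior interface. *)
Definition face_int (nu : pt) (c : R) (E : set pt) (t : pt) (K1 K2 : 'I_N)
    (w v : pw) : R :=
  let avg_dn (p : pw) x :=
    2^-1 * (dot nu (grad (p K1) x) + dot nu (grad (p K2) (x + t))) in
  let jump (p : pw) x := pev (p K2) (x + t) - pev (p K1) x in
  surf_int nu c E (fun x => avg_dn w x * jump v x + jump w x * avg_dn v x).

(* Interior interfaces: the (d-1)-dimensional sets [face i `&` cell_closed K2],
   i a face of K1; K1 < K2 picks one orientation for each of them. *)
Definition dgA0 (a : R) (w v : pw) : R :=
  \sum_(K < N) vol_int (cell_open (T K)) (fun x =>
      dot (grad (w K) x) (grad (v K) x) - a / 2 * pev (w K) x * pev (v K) x)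
  + \sum_(K1 < N) \sum_(K2 < N | (K1 < K2)%N) \sum_(i < nface (T K1))
      let nu := normal i in let c := offset i in
      let E := face i `&` cell_closed (T K2) in
      if `[< flat_full nu c E >] then face_int nu c E 0 K1 K2 w v else 0.

(* Boundary faces in the periodic case: the (d-1)-dimensional intersections of a
   face of K1 on the boundary with the translate of an element K2. *)
Definition dgAb (bc : bcond R d) (w v : pw) : R :=
  match bc with
  | Periodic t => 2^-1 *
      \sum_(K1 < N) \sum_(i < nface (T K1) | `[< boundary_face Omega i >])
      \sum_(K2 < N)
        let nu := normal i in let c := offset i in
        let E := [set x | face i x /\ cell_closed (T K2) (x + t nu)] in
        if `[< flat_full nu c E >] then face_int nu c E (t nu) K1 K2 w v else 0
  | NoFlux => 0
  end.

Variables (bc : bcond R d) (a : R).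

Definition dgA (w v : pw) : R := dgA0 a w v + dgAb bc w v.

Definition L2proj (f : pt -> R) : pw :=
  xget 0 [set p | Vh p /\ forall phi, Vh phi -> L2ip (fn p) (fn phi) = L2ip f (fn phi)].

Definition Lh (v : pw) : pw :=
  xget 0 [set w | Vh w /\ forall psi, Vh psi -> L2ip (fn w) (fn psi) = dgA v psi].

(* (I + tau Lh^2)^-1 on Vh *)
Definition Bh (tau : R) (f : pw) : pw :=
  xget 0 [set v | Vh v /\ v + tau *: Lh (Lh v) = f].

Variables (Phi : R -> R) (B : R).

Definition sav_b (w : pt -> R) (x : pt) : R :=
  derive1 Phi (w x) / Num.sqrt (vol_int Omega (Phi \o w) + B).

Variables (dt : R) (un um qn : pw) (rn : R). (* u^n, u^{n-1}, q^n, r^n *)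

Definition ustar : pw := (3 / 2 : R) *: un - (1 / 2 : R) *: um.

(* rh stands for r^{n+1/2} *)
Definition linear_system (rh : R) (u q : pw) : Prop :=
  (forall phi, Vh phi ->
     L2ip (fn (dt^-1 *: (u - un))) (fn phi) =
       - dgA ((1 / 2 : R) *: (qn + q)) phi - rh * L2ip (sav_b (fn ustar)) (fn phi)) /\
  (forall psi, Vh psi -> L2ip (fn q) (fn psi) = dgA u psi).

Definition sav_step (u q : pw) (r : R) : Prop :=
  [/\ Vh u, Vh q, linear_system ((rn + r) / 2) u q &
      (r - rn) / dt =
        1 / 2 * vol_int Omega (fun x => sav_b (fn ustar) x * fn (dt^-1 *: (u - un)) x)].

Definition xi_star : pw :=
  let Pb := L2proj (sav_b (fn ustar)) in
  un - (1 / 2 * dt * rn) *: Pb + (dt / 4 * L2ip (sav_b (fn ustar)) (fn un)) *: Pb.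

Definition R_star : R :=
  let Pb := L2proj (sav_b (fn ustar)) in
  L2ip (sav_b (fn ustar)) (fn (Bh (dt / 2) xi_star)) /
    (1 + dt / 4 * L2ip (fn Pb) (fn (Bh (dt / 2) Pb))).

Definition r_half : R :=
  rn - 1 / 2 * L2ip (fn (L2proj (sav_b (fn ustar)))) (fn un) + 1 / 2 * R_star.

Definition two_step (u q : pw) (r : R) : Prop :=
  [/\ Vh u, Vh q, r = 2 * r_half - rn & linear_system r_half u q].

End DG.

(* Main.v *)
(** On the finite-dimensional space V_h the operator L_h is self-adjoint, so
    I + tau L_h^2 is positive definite and B_h(tau) exists. Writing
    w = u^{n+1/2} and p = Pi b(u^{n,*}), elimination of q turns the first two
    equations of the scheme into w = B_h(dt/2) (u^n - (dt/2) r^{n+1/2} p), and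
    the third one into r^{n+1/2} = r^n - (p, u^n)/2 + (p, w)/2. Pairing the former
    with p gives a scalar equation for (p, w), whose coefficient
    1 + (dt/4) (p, B_h(dt/2) p) is at least 1 and whose solution is R^{n,*}.

    The bilinear forms are linear because all integrands are bounded and measurable
    on bounded measurable sets; the L^2 product is definite on V_h because a
    polynomial that vanishes on a box is zero and boxes have positive measure. *)
Require Import Defs.
From HB Require Import structures.
From mathcomp Require Import all_boot all_order all_algebra.
From mathcomp Require Import all_classical all_reals all_analysis.
From mathcomp Require Import measurable_realfun.
From mathcomp Require Import ring lra.
From mathcomp Require Import (canonicals, coercions) mpoly.
Import Order.TTheory GRing.Theory Num.Theory numFieldNormedType.Exports.
Local Open Scope classical_set_scope.
Local Open Scope ring_scope.

(** * The abstract time step *)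

(** In coordinates this is a linear system with the Gram matrix [G] of [c] on the free family [e]. A
    row vector killed by [G] gives a combination [w] with [c w w = 0], so definiteness makes [G]
    invertible. *)
Lemma lax_milgram (F : fieldType) (V : lmodType F) (I : finType) (e : I -> V)
    (c : V -> V -> F) (l : V -> F) :
  (forall x : I -> F, \sum_i x i *: e i = 0 -> forall i, x i = 0) ->
  (forall w, scalar (c^~ w)) -> (forall w, scalar (c w)) ->
  (forall w, c w w = 0 -> w = 0) -> scalar l ->
  exists x : I -> F, forall y : I -> F,
    c (\sum_i x i *: e i) (\sum_i y i *: e i) = l (\sum_i y i *: e i).
Proof.
move=> free_e cl cr c0 ll.
have sum_scalar f : scalar f ->
    forall x : I -> F, f (\sum_i x i *: e i) = \sum_i x i * f (e i).
  move=> lf x; have f0 : f 0 = 0.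
    by have := lf (-1) 0 0; rewrite scaler0 addr0 mulN1r addNr.
  by elim/big_rec2: _ => [//|i _ s _ <-]; exact: lf.
pose G : 'M[F]_#|I| := \matrix_(i, j) c (e (enum_val i)) (e (enum_val j)).
pose row_of (x : I -> F) : 'rV_#|I| := \row_i x (enum_val i).
have GE x (j : I) :
    c (\sum_i x i *: e i) (e j) = (row_of x *m G) 0 (enum_rank j).
  rewrite (sum_scalar (c^~ (e j)))// mxE (reindex (@enum_val I predT))/=; last first.
    by exists enum_rank => i _; rewrite (enum_valK, enum_rankK).
  by apply: eq_bigr => i _; rewrite !mxE enum_rankK.
have Gfree : row_free G.
  apply: inj_row_free => v vG.
  pose x i := v 0 (enum_rank i).
  have vE : v = row_of x by apply/rowP => i; rewrite mxE /x enum_valK.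
  have /c0/free_e x0 : c (\sum_i x i *: e i) (\sum_i x i *: e i) = 0.
    rewrite (sum_scalar (c _))// big1// => j _.
    by rewrite GE -vE vG mxE mulr0.
  by rewrite vE; apply/rowP => i; rewrite !mxE x0.
pose v := (row_of (l \o e) *m invmx G).
exists (fun i => v 0 (enum_rank i)) => y.
rewrite (sum_scalar (c _))// sum_scalar//; apply: eq_bigr => j _; congr (_ * _).
rewrite GE (_ : row_of _ = v); last by apply/rowP => i; rewrite mxE enum_valK.
by rewrite mulmxKV -?row_free_unit// mxE /= enum_rankK.
Qed.

(** * The SAV step in an abstract inner product space, [S] standing for V_h *)

Section CrankNicolsonStep.
Context {R : realFieldType} {V : lmodType R}.
Variables (S : set V) (ip A : V -> V -> R) (L : V -> V).
Hypotheses (S_lin : forall x u v, S u -> S v -> S (x *: u + v))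
  (ipC : forall u v, ip u v = ip v u) (ip_lin : forall w, scalar (ip w))
  (ip_ge0 : forall v, 0 <= ip v v) (ip_eq0 : forall v, ip v v = 0 -> v = 0)
  (A_lin : forall w, scalar (A^~ w))
  (AC : forall u v, A u v = A v u)
  (SL : forall v, S (L v)) (LE : forall v w, S w -> ip (L v) w = A v w).

Lemma S_scale x u : S u -> S (x *: u).
Proof.
move=> Su; have S0 : S 0 by rewrite -[0](addNr u) -scaleN1r; exact: S_lin.
by rewrite -[_ *: _]addr0; exact: S_lin.
Qed.

Lemma S_add u v : S u -> S v -> S (u + v).
Proof. by move=> Su Sv; rewrite -[u]scale1r; exact: S_lin. Qed.

Lemma ipr0 w : ip w 0 = 0.
Proof. by have := ip_lin w (-1) 0 0; rewrite scaler0 addr0 mulN1r addNr. Qed.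

Lemma ipDr w u v : ip w (u + v) = ip w u + ip w v.
Proof. by rewrite -[u]scale1r ip_lin mul1r scale1r. Qed.

Lemma ipZr w x u : ip w (x *: u) = x * ip w u.
Proof. by rewrite -[x *: u]addr0 ip_lin ipr0 addr0. Qed.

Lemma ipBr w u v : ip w (u - v) = ip w u - ip w v.
Proof. by rewrite addrC -scaleN1r ip_lin mulN1r addrC. Qed.

(** Test with [u - v], which lies in [S], and use definiteness. This turns weak identities into
    equalities of vectors. *)
Lemma ip_inj u v : S u -> S v -> (forall w, S w -> ip u w = ip v w) -> u = v.
Proof.
move=> Su Sv uv; apply/subr0_eq/ip_eq0.
have Suv : S (u - v) by rewrite -scaleN1r; apply: S_add => //; exact: S_scale.
have := uv _ Suv; set w := u - v; rewrite ipC (ipC v) => {}uv.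
by rewrite {2}/w ipBr uv subrr.
Qed.

(** Linearity is inherited from [A], since the representative [L v] in [S] is unique. *)
Lemma L_scalar x u v : L (x *: u + v) = x *: L u + L v.
Proof.
apply: ip_inj; [exact: SL| exact: S_lin |move=> w Sw].
by rewrite LE// A_lin (ipC _ w) ip_lin !(ipC w) !LE.
Qed.

Lemma L_add u v : L (u + v) = L u + L v.
Proof. by rewrite -[u]scale1r L_scalar !scale1r. Qed.

Lemma L_scale x u : L (x *: u) = x *: L u.
Proof.
have L0 : L 0 = 0 by apply: (addrI (L 0)); rewrite -L_add !addr0.
by rewrite -[x *: u]addr0 L_scalar L0 addr0.
Qed.

Lemma L_adjoint u v : S u -> S v -> ip (L u) v = ip u (L v).
Proof. by move=> Su Sv; rewrite LE// ipC LE// AC. Qed.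

(* The weak form of [v + tau L^2 v = f] is [(v, w) + tau (L v, L w) = (f, w)], whose
   left-hand side is positive definite. *)
Lemma resolvent_ex (tau : R) f :
  (forall c : V -> V -> R, (forall w, scalar (c^~ w)) -> (forall w, scalar (c w)) ->
    (forall w, c w w = 0 -> w = 0) ->
    exists v, S v /\ forall w, S w -> c v w = ip f w) ->
  0 <= tau -> S f -> exists v, S v /\ v + tau *: L (L v) = f.
Proof.
move=> riesz tau0 Sf; pose c u v := ip u v + tau * ip (L u) (L v).
have c_lin u : scalar (c u).
  move=> x v w; rewrite /c L_scalar !ip_lin; ring.
have cC u v : c u v = c v u by rewrite /c ipC (ipC (L u)).
have [|||v [Sv vE]] := riesz c; [|exact: c_lin| |].
- by move=> u x v w; rewrite !(cC _ u) c_lin.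
- move=> w w0; apply: ip_eq0; move: w0; rewrite /c.
  have := ip_ge0 w; have := mulr_ge0 tau0 (ip_ge0 (L w)); lra.
exists v; split=> //; apply: ip_inj => //; first by rewrite addrC; exact: S_lin.
by move=> w Sw; rewrite -vE// /c ipC ipDr ipZr ipC -L_adjoint// (ipC _ (L v)).
Qed.

Variables (Bo : V -> V) (dt : R) (un qn P : V) (rn : R).
Hypotheses (SBo : forall f, S f -> S (Bo f))
  (BoE : forall f, S f -> Bo f + (dt / 2) *: L (L (Bo f)) = f)
  (dt_gt0 : 0 < dt) (Sun : S un) (SP : S P)
  (Sqn : S qn) (qnE : forall w, S w -> ip qn w = A un w).

(** This and the next three definitions mirror [linear_system], [sav_step], [xi_star] and [r_half],
    with b(u^{n,*}) replaced by its projection [P]. The replacement is harmless because b is only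
    ever paired with elements of V_h. *)
Definition cn_system rh u q :=
  (forall w, S w -> ip (dt^-1 *: (u - un)) w =
     - A ((1 / 2 : R) *: (qn + q)) w - rh * ip P w) /\
  (forall w, S w -> ip q w = A u w).

Definition cn_step u q r :=
  [/\ S u, S q, cn_system ((rn + r) / 2) u q &
      (r - rn) / dt = 1 / 2 * ip P (dt^-1 *: (u - un))].

Definition cn_xi := un - (1 / 2 * dt * rn) *: P + (dt / 4 * ip P un) *: P.

Definition cn_rhalf := rn - 1 / 2 * ip P un +
  1 / 2 * (ip P (Bo cn_xi) / (1 + dt / 4 * ip P (Bo P))).

(** Pairing the equation for the difference [w] with [w] itself gives |w|^2 + (dt/2) |L w|^2 = 0, by
    self-adjointness of [L]. *)
Lemma implicit_inj u v : S u -> S v ->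
  u + (dt / 2) *: L (L u) = v + (dt / 2) *: L (L v) -> u = v.
Proof.
move=> Su Sv uv; apply/subr0_eq; set w := u - v.
have Sw : S w by rewrite /w addrC -scaleN1r; exact: S_lin.
have w0 : w + (dt / 2) *: L (L w) = 0.
  rewrite /w [u - v]addrC -scaleN1r !L_scalar !scaleN1r.
  apply/eqP; rewrite scalerDr scalerN addrACA -opprD addrC subr_eq0; exact/eqP.
have : ip w (w + (dt / 2) *: L (L w)) = 0 by rewrite w0 ipr0.
rewrite ipDr ipZr -L_adjoint// => H; apply: ip_eq0.
by have := ip_ge0 w; have := mulr_ge0 (ltW dt_gt0) (ip_ge0 (L w)); lra.
Qed.

Lemma Bo_eq f v : S f -> S v -> v + (dt / 2) *: L (L v) = f -> v = Bo f.
Proof.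
by move=> Sf Sv vf; apply: implicit_inj => //; [exact: SBo|rewrite BoE].
Qed.

Lemma Bo_scalar x f g : S f -> S g -> Bo (x *: f + g) = x *: Bo f + Bo g.
Proof.
move=> Sf Sg; apply/esym/Bo_eq.
- exact: S_lin.
- by apply: S_lin; exact: SBo.
- rewrite !L_scalar -[in RHS](BoE _ Sf) -[in RHS](BoE _ Sg).
  by rewrite !scalerDr addrACA !scalerA (mulrC x).
Qed.

(** With g = [Bo f] and f = g + (dt/2) L^2 g, the product is |g|^2 + (dt/2) |L g|^2. This is what
    keeps the denominator of R^{n,*} positive. *)
Lemma ip_Bo_ge0 f : S f -> 0 <= ip f (Bo f).
Proof.
move=> Sf; rewrite -{1}(BoE _ Sf) ipC ipDr ipZr -L_adjoint//; last exact: SBo.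
by rewrite addr_ge0// mulr_ge0// divr_ge0// ltW.
Qed.

(** Eliminating [q] and passing to the midpoint leaves a single equation governed by I + (dt/2) L^2,
    which [Bo] inverts. *)
Lemma cn_systemP rh u q : S u -> S q ->
  cn_system rh u q <->
  u = 2 *: Bo (un - (dt / 2 * rh) *: P) - un /\ q = L u.
Proof.
move=> Su Sq; set f := un - _.
have Sf : S f by rewrite /f addrC -scaleNr; exact: S_lin.
have qnL : qn = L un by apply: ip_inj => // w Sw; rewrite LE// qnE.
have qP : (forall w, S w -> ip q w = A u w) <-> q = L u.
  split=> [qA|-> w Sw]; last by rewrite LE.
  by apply: ip_inj => // w Sw; rewrite LE// qA.
(* [uh] is the midpoint u^{n+1/2}: in terms of it the difference quotient is (2/dt) ([uh] - [un])
   and the averaged [q] is [L uh]. *)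
pose uh := (1 / 2 : R) *: (un + u).
have Suh : S uh by apply/S_scale/S_add.
have uE : u = 2 *: uh - un.
  by rewrite /uh scalerA mulrCA divff ?mulr1 ?scale1r ?pnatr_eq0// addrC addKr.
have uhL : q = L u -> (1 / 2 : R) *: (qn + q) = L uh.
  by move=> ->; rewrite qnL L_scale L_add.
clearbody uh; rewrite /cn_system qP.
have sysP : q = L u ->
    (forall w, S w -> ip (dt^-1 *: (u - un)) w =
      - A ((1 / 2 : R) *: (qn + q)) w - rh * ip P w) <->
    uh + (dt / 2) *: L (L uh) = f.
  move=> qL; rewrite (uhL qL).
  have dE : dt^-1 *: (u - un) = (2 / dt) *: (uh - un).
    have un2 : un + un = 2 *: un by rewrite scaler_nat mulr2n.
    by rewrite uE -addrA -opprD un2 -scalerBr scalerA mulrC.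
  have lhs w : ip (dt^-1 *: (u - un)) w = 2 / dt * (ip w uh - ip w un).
    by rewrite dE ipC ipZr ipBr.
  have rhs w : S w -> - A (L uh) w - rh * ip P w = 
      - ip w (L (L uh)) - rh * ip w P.
    by move=> Sw; rewrite -LE// (ipC _ w) (ipC P).
  have dt0 : dt != 0 by rewrite gt_eqF.
  split=> [E|E w Sw].
    apply: ip_inj => //; first by rewrite addrC; apply: S_lin.
    move=> w Sw; have := E w Sw; rewrite lhs rhs// => {}E.
    rewrite ipC [RHS]ipC /f -scaleNr !ipDr !ipZr.
    (* The residual of the midpoint equation tested with [w] is dt/2 times the residual of the
       scheme tested with [w]. *)
    apply/eqP; rewrite -subr_eq0.
    have -> : ip w uh + dt / 2 * ip w (L (L uh)) - (ip w un + - (dt / 2 * rh) * ip w P)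
      = dt / 2 * (2 / dt * (ip w uh - ip w un) - (- ip w (L (L uh)) - rh * ip w P)).
      by field.
    by rewrite E subrr mulr0.
  rewrite lhs rhs//; have := congr1 (ip w) E.
  rewrite /f -scaleNr !ipDr !ipZr => {}E.
  have -> : ip w uh = ip w un + - (dt / 2 * rh) * ip w P - dt / 2 * ip w (L (L uh)).
    by rewrite -E addrK.
  by field.
split=> -[Eu qL]; split=> //.
  by rewrite {1}uE; congr (_ *: _ - _); apply: Bo_eq => //; exact/(sysP qL).
apply/(sysP qL); have -> : uh = Bo f; last exact: BoE.
by apply: (@scalerI _ _ 2); rewrite ?pnatr_eq0//; apply: (addIr (- un)); rewrite -uE.
Qed.

Lemma ip_Bo_affine x : ip P (Bo (un - x *: P)) = ip P (Bo un) - x * ip P (Bo P).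
Proof.
by rewrite addrC -scaleNr Bo_scalar// ip_lin addrC mulNr.
Qed.

Lemma cn_denom_gt0 : 0 < 1 + dt / 4 * ip P (Bo P).
Proof.
rewrite ltr_wpDr// mulr_ge0 ?ip_Bo_ge0// ltW// divr_gt0//.
Qed.

(** By [cn_systemP], [u] is an affine function of r^{n+1/2}. Inserting it into the equation for [r]
    leaves one scalar affine equation with nonzero leading coefficient, and [cn_rhalf] is its
    root. *)
Lemma cn_stepP u q r :
  cn_step u q r <->
  [/\ S u, S q, r = 2 * cn_rhalf - rn & cn_system cn_rhalf u q].
Proof.
have dt0 : dt != 0 by rewrite gt_eqF.
have D0 := cn_denom_gt0.
have D4 : 4 + dt * ip P (Bo P) != 0.
  by rewrite gt_eqF//; move: D0; lra.
(* Closed form of [cn_rhalf]: since [Bo] is linear, the terms of [cn_xi] along [P] cancel against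
   the denominator, and (P, Bo P) survives only below the fraction line. *)
have rhE : cn_rhalf = (4 * rn + 2 * ip P (Bo un) - 2 * ip P un) /
                      (4 + dt * ip P (Bo P)).
  have xE x y : un - x *: P + y *: P = un - (x - y) *: P.
    by rewrite scalerBl opprB addrA addrAC.
  rewrite /cn_rhalf /cn_xi xE ip_Bo_affine.
  by field; rewrite D4.
have scal rh : ip P (dt^-1 *: (2 *: Bo (un - (dt / 2 * rh) *: P) - un - un)) =
    dt^-1 * (2 * (ip P (Bo un) - dt / 2 * rh * ip P (Bo P)) - 2 * ip P un).
  by rewrite ipZr !ipBr ipZr ip_Bo_affine; ring.
split=> [[Su Sq sys E]|[Su Sq rE sys]].
  have rh : (rn + r) / 2 = cn_rhalf.
    have [uE _] := (cn_systemP _ _ _ Su Sq).1 sys.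
    move: E; rewrite {1}uE scal rhE => E.
    (* Together with r = 2 r^{n+1/2} - r^n, this is the scalar equation for r^{n+1/2}. *)
    have {}E : r - rn = ip P (Bo un) - dt / 2 * ((rn + r) / 2) * ip P (Bo P) - ip P un.
      have -> : r - rn = dt * ((r - rn) / dt) by field.
      by rewrite E; field.
    by apply/eqP; rewrite eq_sym eqr_div ?pnatr_eq0//; apply/eqP; lra.
  by split=> //; [rewrite -rh; field|rewrite -rh].
have rh : (rn + r) / 2 = cn_rhalf by rewrite rE; field.
split=> //; first by rewrite rh.
have [uE _] := (cn_systemP _ _ _ Su Sq).1 sys.
rewrite {1}uE scal rE rhE; field.
by rewrite D4.
Qed.

(** The two-step side is explicit: first [r], then [u] through [Bo], then [q] through [L]. Existence
    and uniqueness are read off from it. *)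
Lemma cn_realization :
  (exists u q r, cn_step u q r /\
     forall u' q' r', cn_step u' q' r' -> [/\ u' = u, q' = q & r' = r]) /\
  (forall u q r, cn_step u q r <->
     [/\ S u, S q, r = 2 * cn_rhalf - rn & cn_system cn_rhalf u q]).
Proof.
split; last exact: cn_stepP.
pose u := 2 *: Bo (un - (dt / 2 * cn_rhalf) *: P) - un.
have Su : S u.
  have Sf : S (un - (dt / 2 * cn_rhalf) *: P).
    by rewrite addrC -scaleNr; exact: S_lin.
  by rewrite /u addrC -scaleN1r; apply: S_lin => //; apply/S_scale/SBo.
exists u, (L u), (2 * cn_rhalf - rn); split.
  by apply/cn_stepP; split => //; apply/cn_systemP.
by move=> u' q' r' /cn_stepP[Su' Sq' -> /(cn_systemP _ _ _ Su' Sq')[-> ->]].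
Qed.

End CrankNicolsonStep.

(** * Multivariate polynomials *)

Lemma poly_eq0_ball (R : numFieldType) (q : {poly R}) (c r : R) : 0 < r ->
  (forall t, `|t - c| < r -> q.[t] = 0) -> q = 0.
Proof.
(* As many distinct roots as [size q] force [q = 0]. The denominators start at 2 so that every point
   stays strictly within distance [r] of [c]. *)
move=> r0 q0; pose s := [seq c + r / n.+2%:R | n <- iota 0 (size q)].
apply: (@roots_geq_poly_eq0 _ q s); last by rewrite size_map size_iota.
  apply/allP => _ /mapP[n _ ->]; apply/rootP/q0.
  rewrite addrC addKr normrM (gtr0_norm r0) normfV normr_nat.
  by rewrite ltr_pdivrMr ?ltr0n// ltr_pMr// ltr1n.
rewrite map_inj_uniq ?iota_uniq// => m n /addrI/(mulfI (lt0r_neq0 r0))/invr_inj.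
by move=> /eqP; rewrite eqr_nat => /eqP[].
Qed.

Section MpolyLastVariable.
Context {R : comNzRingType} {n : nat}.
Implicit Types p : mpoly.mpoly n.+1 R.

Let low (m : mpoly.multinom n.+1) : mpoly.multinom n :=
  mpoly.Multinom [tuple m (widen_ord (leqnSn n) i) | i < n].

Let mnm_low m m' : low m = low m' -> m ord_max = m' ord_max -> m = m'.
Proof.
move=> /mpoly.mnmP mm' mx; apply/mpoly.mnmP => i.
have [->//|ix] := eqVneq i ord_max.
have lti : (i < n)%N by rewrite ltn_neqAle -ltnS ltn_ord andbT.
have := mm' (Ordinal lti); rewrite !mpoly.mnmE.
by rewrite (_ : widen_ord _ _ = i)//; exact: val_inj.
Qed.

(** [mpoly.muni p] is [p] seen as a univariate polynomial in the last variable. The coefficient of a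
    monomial [m] in [p] is found there by splitting [m] into its last exponent and [low m]. *)
Lemma muni_eq0 p : mpoly.muni p = 0 -> p = 0.
Proof.
move=> p0; apply/mpoly.mpolyP => m; rewrite mpoly.mcoeff0.
transitivity (mpoly.mcoeff (low m) (mpoly.muni p)`_(m ord_max)); last first.
  by rewrite p0 coef0 mpoly.mcoeff0.
rewrite {1}(mpoly.mpolyE p) mpoly.muniE coef_sum !raddf_sum/=.
apply: eq_bigr => m' _.
rewrite coefZ coefXn mpoly.mcoeffZ mpoly.mcoeffX.
have [<-|mm'] := eqVneq m' m; first by rewrite !eqxx !mulr1 mpoly.mcoeffZ mpoly.mcoeffX eqxx mulr1.
have [mx|_] := eqVneq (m ord_max) (m' ord_max); last by rewrite !mulr0 mpoly.mcoeff0.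
rewrite mulr1 mpoly.mcoeffZ mpoly.mcoeffX; congr (_ * _).
case: eqVneq => // /mnm_low mE; case/eqP: mm'; exact: mE.
Qed.

(** The point (y, t): [insub] fails exactly at the last index, where the default [t] is taken. *)
Definition rcons_fun (y : 'I_n -> R) (t : R) (i : 'I_n.+1) : R :=
  oapp y t (insub (val i)).

Lemma horner_muni p y t :
  (map_poly (mpoly.meval y) (mpoly.muni p)).[t] = mpoly.meval (rcons_fun y t) p.
Proof.
rewrite mpoly.mevalE mpoly.muniE raddf_sum horner_sum; apply: eq_bigr => m _ /=.
rewrite map_polyZ map_polyXn hornerZ hornerXn /= mpoly.mevalZ mpoly.mevalX.
rewrite big_ord_recr/= -mulrA; congr (_ * (_ * _)).
  apply: eq_bigr => i _; rewrite mpoly.mnmE /rcons_fun insubT//=.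
  by move=> lt_in; congr (y _ ^+ _); exact: val_inj.
by rewrite /rcons_fun insubF//= ltnn.
Qed.

End MpolyLastVariable.

(** Induction on the number of variables. For fixed first coordinates [y] in the box, the polynomial
    in the last variable vanishes on an interval, so each of its coefficients vanishes at [y]; the
    induction hypothesis then applies to these coefficients. *)
Lemma mpoly_eq0_box (R : numFieldType) n (p : mpoly.mpoly n R) (c : 'I_n -> R) (r : R) :
  0 < r -> (forall x, (forall i, `|x i - c i| < r) -> mpoly.meval x p = 0) -> p = 0.
Proof.
move=> r0; elim: n => [|n IH] in p c *.
  move=> p0; have : mpoly.meval c p = 0 by apply: p0; case.
  by rewrite [p]mpoly.nvar0_mpolyC mpoly.mevalC => ->; rewrite mpoly.mpolyC0.
move=> p0; apply/muni_eq0/polyP => j; rewrite coef0.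
apply: (IH _ (c \o widen_ord (leqnSn n))) => y yc.
rewrite -coef_map; have -> : map_poly (mpoly.meval y) (mpoly.muni p) = 0; last by rewrite coef0.
apply: (@poly_eq0_ball _ _ (c ord_max) _ r0) => t tc.
rewrite horner_muni; apply: p0 => i; rewrite /rcons_fun.
case: insubP => [k _ ki|]/=.
  by rewrite (_ : i = widen_ord (leqnSn n) k)//; apply: val_inj.
by rewrite -leqNgt => ni; rewrite (_ : i = ord_max)//; apply/val_inj/eqP; rewrite eqn_leq ni -ltnS ltn_ord.
Qed.

Section Eval.
Context {R : realType} {d : nat}.
Local Notation pt := 'rV[R]_d.

Lemma pev_continuous (p : mpoly.mpoly d R) : continuous (pev p).
Proof.
rewrite (_ : pev p = fun x : pt => \sum_(m <- mpoly.msupp p)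
    mpoly.mcoeff m p * \prod_i x ord0 i ^+ m i); last first.
  by apply/funext => x; rewrite /pev mpoly.mevalE.
apply: continuous_big => [|m _ x]; first exact: add_continuous.
apply: continuousM; first exact: cst_continuous.
apply: (@continuous_big _ _ _ _ xpredT) => [|i _ {}x]; first exact: mul_continuous.
apply: (@continuous_comp _ _ _ (fun x : pt => x ord0 i) (fun z : R => z ^+ m i));
  [exact: coord_continuous|exact: exprn_continuous].
Qed.

Lemma dot_continuous (nu : pt) : continuous (dot nu).
Proof.
apply: continuous_big => [|i _ x]; first exact: add_continuous.
by apply: continuousM; [exact: cst_continuous|exact: coord_continuous].
Qed.

(** For positive [r] this is the ball of the sup norm, spelled out by coordinates so that its volume
    is a product of lengths. *)
Definition cube (c : pt) (r : R) : set pt := [set x | forall i, ball (c ord0 i) r (x ord0 i)].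

Lemma nbhs_cube (c : pt) (P : set pt) : nbhs c P -> exists2 r, 0 < r & cube c r `<=` P.
Proof.
move=> /nbhs_ballP[r/= r0 rP]; exists r => // x cx; apply: rP; split=> // i j.
by rewrite ord1; exact: cx.
Qed.

End Eval.

(** * Integration over bounded sets *)

Section TameFunctions.
Context {R : realType} {d : nat}.
Local Notation pt := 'rV[R]_d.
Local Notation tup := (d.-tuple (measurableTypeR R)).
Implicit Types (E : set pt) (f g : pt -> R).

Definition pt_of (t : tup) : pt := \row_i tnth t i.

(** The measure lives on tuples, so measurability of functions and sets of points is read through
    [pt_of]. *)
Definition pt_measurable f := measurable_fun setT (fun t : tup => f (pt_of t)).

(** A class closed under sums, products and composition with continuous functions, and integrable
    over every [region]; this settles all integrability questions below. *)
Definition tame E f := pt_measurable f /\ exists M, forall x, E x -> `|f x| <= M.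

(** Tame coordinates say that [E] is bounded, in the form from which tameness of polynomials on [E]
    is built. *)
Definition region E :=
  measurable (pt_of @^-1` E) /\ forall i, tame E (fun x => x ord0 i).

Lemma pt_measurable_coord i : pt_measurable (fun x => x ord0 i).
Proof.
rewrite /pt_measurable (_ : (fun _ => _) = fun t : tup => tnth t i); last first.
  by apply/funext => t; rewrite mxE.
exact: measurable_tnth.
Qed.

Lemma tame_cst E c : tame E (fun=> c).
Proof. by split; [exact: measurable_cst|exists `|c|]. Qed.

Lemma tameD E f g : tame E f -> tame E g -> tame E (fun x => f x + g x).
Proof.
move=> [mf [M Mf]] [mg [M' Mg]]; split; first exact: measurable_funD.
exists (M + M') => x Ex; apply: (le_trans (ler_normD _ _)).
by apply: lerD; [exact: Mf|exact: Mg].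
Qed.

Lemma tameM E f g : tame E f -> tame E g -> tame E (fun x => f x * g x).
Proof.
move=> [mf [M Mf]] [mg [M' Mg]]; split; first exact: measurable_funM.
exists (M * M') => x Ex; rewrite normrM.
by apply: ler_pM => //; [exact: Mf|exact: Mg].
Qed.

Lemma tameN E f : tame E f -> tame E (fun x => - f x).
Proof.
move=> tf; rewrite (_ : (fun _ => _) = fun x => -1 * f x).
  by apply: tameM => //; exact: tame_cst.
by apply/funext => x; rewrite mulN1r.
Qed.

Lemma tameB E f g : tame E f -> tame E g -> tame E (fun x => f x - g x).
Proof. by move=> tf tg; apply: tameD => //; exact: tameN. Qed.

Lemma tame_sum E (I : Type) (s : seq I) (f : I -> pt -> R) :
  (forall i, tame E (f i)) -> tame E (fun x => \sum_(i <- s) f i x).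
Proof.
move=> tf; elim: s => [|i s IH].
  by under eq_fun do rewrite big_nil; exact: tame_cst.
by under eq_fun do rewrite big_cons; exact: tameD.
Qed.

Lemma tame_prod E (I : Type) (s : seq I) (f : I -> pt -> R) :
  (forall i, tame E (f i)) -> tame E (fun x => \prod_(i <- s) f i x).
Proof.
move=> tf; elim: s => [|i s IH].
  by under eq_fun do rewrite big_nil; exact: tame_cst.
by under eq_fun do rewrite big_cons; exact: tameM.
Qed.

Lemma tameX E f n : tame E f -> tame E (fun x => f x ^+ n).
Proof.
move=> tf; elim: n => [|n IH]; first exact: tame_cst.
by under eq_fun do rewrite exprS; exact: tameM.
Qed.

(** The values of [f] on [E] lie in a compact segment, on which [h] is bounded. *)
Lemma tame_continuous E f (h : R -> R) : continuous h -> tame E f -> tame E (h \o f).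
Proof.
move=> ch [mf [M Mf]]; split.
  by apply: measurableT_comp => //; exact: continuous_measurable_fun.
have [M' [_ hM]] : bounded_set (h @` `[- M, M]%classic).
  apply: compact_bounded; apply: continuous_compact; last exact: segment_compact.
  exact: continuous_subspaceT.
(* [bounded_set] only provides that every number strictly above [M'] is a bound. *)
exists (M' + 1) => x /Mf; rewrite ler_norml => fx.
by apply: (hM (M' + 1)); rewrite ?ltrDl//=; exists (f x) => //; rewrite /= in_itv.
Qed.

(** The inner map [u] is the identity on elements; for face integrals it is the projection onto the
    hyperplane, possibly followed by a translation. *)
Lemma tame_pev E (p : mpoly.mpoly d R) (u : pt -> pt) :
  (forall i, tame E (fun x => u x ord0 i)) -> tame E (fun x => pev p (u x)).
Proof.
move=> tu; under eq_fun do rewrite /pev mpoly.mevalE.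
apply: tame_sum => m; apply: tameM; first exact: tame_cst.
by apply: tame_prod => i; exact: tameX.
Qed.

Lemma tame_dot E (nu : pt) (u : pt -> pt) :
  (forall i, tame E (fun x => u x ord0 i)) -> tame E (fun x => dot nu (u x)).
Proof.
by move=> tu; apply: tame_sum => i; apply: tameM => //; exact: tame_cst.
Qed.

Lemma tame_grad E (p : mpoly.mpoly d R) (u : pt -> pt) i :
  (forall i, tame E (fun x => u x ord0 i)) -> tame E (fun x => grad p (u x) ord0 i).
Proof. by move=> tu; under eq_fun do rewrite mxE; exact: tame_pev. Qed.

Lemma tame_indic E (A : set pt) : measurable (pt_of @^-1` A) -> tame E (\1_A : pt -> R).
Proof.
move=> mA; split.
  rewrite /pt_measurable (_ : (fun _ => _) = \1_(pt_of @^-1` A)); first exact: measurable_indic.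
  by apply/funext => t; rewrite !indicE; congr (_%:R); apply/idP/idP; rewrite !inE.
by exists 1 => x _; rewrite indicE; case: (_ \in _); rewrite ?normr1// normr0.
Qed.

Lemma measurable_le f g : pt_measurable f -> pt_measurable g -> measurable (pt_of @^-1` [set x | f x <= g x]).
Proof.
move=> mf mg; rewrite -[X in measurable X]setTI.
exact: (measurable_fun_le measurableT mf mg).
Qed.

Lemma measurable_lt f g : pt_measurable f -> pt_measurable g -> measurable (pt_of @^-1` [set x | f x < g x]).
Proof.
move=> mf mg; rewrite (_ : [set x | _] = ~` [set x | g x <= f x]).
  by rewrite preimage_setC; apply: measurableC; exact: measurable_le.
by apply/seteqP; split=> x /=; rewrite real_leNgt ?num_real//; [move=> -> //|move/negP; rewrite negbK].
Qed.

Lemma measurable_forall n (A : 'I_n -> set pt) :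
  (forall i, measurable (pt_of @^-1` A i)) ->
  measurable (pt_of @^-1` [set x | forall i, A i x]).
Proof.
move=> mA; rewrite (_ : _ @^-1` _ = \bigcap_(i in [set: 'I_n]) (pt_of @^-1` A i)).
  by apply: fin_bigcap_measurable => // i _; exact: mA.
by apply/seteqP; split=> [x Ax i _|x Ax i]; [exact: Ax|exact: (Ax i)].
Qed.

(** [u] is transported to a map [ut] of tuples, which is measurable because its components are. *)
Lemma measurable_preimage_pt E (u : pt -> pt) : (forall i, pt_measurable (fun x => u x ord0 i)) ->
  measurable (pt_of @^-1` E) -> measurable (pt_of @^-1` (u @^-1` E)).
Proof.
move=> mu mE; pose ut (t : tup) : tup := [tuple u (pt_of t) ord0 i | i < d].
have mut : measurable_fun setT ut.
  apply/measurable_fun_tnthP => i.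
  rewrite (_ : _ \o _ = fun t => u (pt_of t) ord0 i); first exact: mu.
  by apply/funext => t /=; rewrite tnth_mktuple.
rewrite (_ : _ @^-1` _ = setT `&` ut @^-1` (pt_of @^-1` E)); first exact: mut.
rewrite setTI; apply/seteqP; split=> t /=; rewrite (_ : pt_of (ut t) = u (pt_of t))//;
  by apply/rowP => i; rewrite mxE tnth_mktuple.
Qed.

End TameFunctions.

(** Induction on the dimension: under the consing map the cube pulls back to an interval times a
    cube of one dimension less, and the product measure multiplies. In dimension 0 the Dirac mass
    gives 1. *)
Lemma lebesgue_tuple_cube (R : realType) n (c : 'I_n -> R) (r : R) : 0 <= r ->
  let Q := [set t : n.-tuple (measurableTypeR R) | forall i, ball (c i) r (tnth t i)] in
  measurable Q /\ lebesgue_tuple R n Q = ((r *+ 2) ^+ n)%:E.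
Proof.
move=> r0; elim: n => [|n IH] in c *; move=> Q.
  have -> : Q = setT by apply/seteqP; split=> // t _; case.
  by split => //=; rewrite diracT.
have [mQ' muQ'] := IH (c \o lift ord0).
set Q' := [set t | _] in mQ' muQ'.
have tnthS (t : n.+1.-tuple (measurableTypeR R)) i :
    tnth [tuple of behead t] i = tnth t (lift ord0 i).
  by rewrite tnth_behead; congr (tnth t _); apply: val_inj; rewrite /= inordK// ltnS.
have QE t : Q t <-> ball (c ord0) r (tnth t ord0) /\ Q' [tuple of behead t].
  split=> [Qt|[t0 Qt] i].
    by split=> [|i]; [exact: Qt|rewrite tnthS; exact: Qt].
  case: (unliftP ord0 i) => [j|] -> //.
  by rewrite -tnthS; exact: Qt.
have mb : measurable (ball (c ord0) r : set (measurableTypeR R)) by exact: measurable_ball.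
split.
  rewrite (_ : Q = (fun t => (tnth t ord0, [tuple of behead t])) @^-1` (ball (c ord0) r `*` Q')).
    rewrite -[X in measurable X]setTI; apply: measurable_fun_pair => //.
    - exact: measurable_tnth.
    - exact: measurable_behead.
    - exact: measurableX.
  by apply/seteqP; split=> t /QE.
rewrite /= /lebesgue_cons /pushforward.
rewrite (_ : _ @^-1` _ = ball (c ord0) r `*` Q').
  rewrite product_measure1E// [X in (_ * X)%E]muQ' [X in (X * _)%E]lebesgue_measure_ball//.
  by rewrite -EFinM -exprS.
apply/seteqP; split=> -[x t] /=; rewrite (QE [tuple of x :: t]) /=.
all: have -> : [tuple of behead (x :: t)] = t by apply: val_inj.
all: by [].
Qed.

(** * Linearity and positivity of the volume integral *)

Section VolumeIntegral.
Context {R : realType} {d : nat}.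
Local Notation pt := 'rV[R]_d.
Local Notation tup := (d.-tuple (measurableTypeR R)).
Local Notation mu := (lebesgue_tuple R d).
Implicit Types (E : set pt) (f g : pt -> R).

Lemma cube_measurable (c : pt) r : 0 <= r -> measurable (pt_of @^-1` cube c r).
Proof.
move=> r0; have [mQ _] := lebesgue_tuple_cube _ _ (fun i => c ord0 i) _ r0.
rewrite (_ : _ @^-1` _ = [set t | forall i, ball (c ord0 i) r (tnth t i)])//.
by apply/seteqP; split=> t ct i; have := ct i; rewrite mxE.
Qed.

Lemma cube_volume (c : pt) r : 0 <= r -> mu (pt_of @^-1` cube c r) = ((r *+ 2) ^+ d)%:E.
Proof.
move=> r0; have [_ <-] := lebesgue_tuple_cube _ _ (fun i => c ord0 i) _ r0.
by congr (mu _); apply/seteqP; split=> t ct i; have := ct i; rewrite mxE.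
Qed.

Lemma region_volume E : region E -> (mu (pt_of @^-1` E) < +oo)%E.
Proof.
move=> [mE tE]; have [M ME] := choice (fun i => (tE i).2).
(* The summand 1 makes the coordinate bounds strict, as the open cube requires. *)
pose r := 1 + \sum_i `|M i|.
have r0 : 0 <= r by rewrite addr_ge0// sumr_ge0.
apply: (@le_lt_trans _ _ (mu (pt_of @^-1` cube 0 r))); last first.
  by rewrite cube_volume// ltry.
apply: le_measure; rewrite ?inE//; first exact: cube_measurable.
move=> t Et i; rewrite mxE /ball/= sub0r normrN.
apply: (le_lt_trans (ME i _ Et)); rewrite (le_lt_trans (ler_norm _))//.
by rewrite /r (bigD1 i)//= addrCA ltr_pwDr// ltr_pwDl// sumr_ge0.
Qed.

Lemma region_integrable E f : region E -> tame E f ->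
  mu.-integrable (pt_of @^-1` E) (EFin \o (fun t : tup => f (pt_of t))).
Proof.
move=> rE [mf [M Mf]]; apply: measurable_bounded_integrable.
- exact: rE.1.
- exact: region_volume.
- exact: measurable_funTS.
- exists M; split; first exact: num_real.
  by move=> M' /ltW MM' t Et; apply: le_trans MM'; exact: Mf.
Qed.

Lemma eq_vol_int E f g : (forall x, E x -> f x = g x) -> vol_int E f = vol_int E g.
Proof. by move=> fg; apply: eq_Rintegral => t; rewrite inE => /fg. Qed.

Lemma vol_int_linear E f g h a : region E -> tame E f -> tame E g ->
  (forall x, E x -> h x = a * f x + g x) ->
  vol_int E h = a * vol_int E f + vol_int E g.
Proof.
move=> rE tf tg /eq_vol_int ->; rewrite /vol_int RintegralD.
- by rewrite RintegralZl//; [exact: rE.1|exact: region_integrable].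
- exact: rE.1.
- exact: (region_integrable _ _ rE (tameM _ _ _ (tame_cst E a) tf)).
- exact: region_integrable.
Qed.

(** Both sides integrate the same function extended by zero. It serves to replace [Omega] by the
    union of the open elements. *)
Lemma vol_int_support (Omega E : set pt) f : E `<=` Omega ->
  (forall x, ~ E x -> f x = 0) -> vol_int Omega f = vol_int E f.
Proof.
move=> EO f0; rewrite /vol_int Rintegral_mkcond [RHS]Rintegral_mkcond.
congr (Rintegral _ _ _); apply/funext => t; rewrite /patch.
have [Et|nEt] := pselect (E (pt_of t)).
  by rewrite !mem_set//; exact: EO.
by rewrite [X in _ = if X then _ else _]memNset// f0//; case: ifP.
Qed.

Lemma vol_int_ge0 E f : (forall x, E x -> 0 <= f x) -> 0 <= vol_int E f.
Proof. by move=> f0; apply: Rintegral_ge0 => t; exact: f0. Qed.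

(** Near [c] there is a cube on which [f] is at least [e], so the integral is at least [e] times the
    positive volume of that cube. *)
Lemma vol_int_gt0 E f (c : pt) (e : R) : region E -> tame E f ->
  (forall x, E x -> 0 <= f x) -> 0 < e ->
  (\forall x \near c, E x /\ e <= f x) -> 0 < vol_int E f.
Proof.
move=> rE tf f0 e0 /nbhs_cube[r r0 cube_sub].
have mQ := cube_measurable c r (ltW r0).
have QE : cube c r `<=` E by move=> x /cube_sub[].
have tQ : tame E (\1_(cube c r) : pt -> R) by exact: tame_indic.
apply: (@lt_le_trans _ _ (vol_int E (fun x => e * \1_(cube c r) x))).
  rewrite /vol_int RintegralZl; [|exact: rE.1|exact: region_integrable].
  rewrite mulr_gt0// /Rintegral.
  under eq_integral => t _.
    rewrite (_ : \1_(cube c r) (pt_of t) = \1_(pt_of @^-1` cube c r) t); last first.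
      by rewrite !indicE; congr (_%:R); apply/idP/idP; rewrite !inE.
    over.
  rewrite integral_indic//; last exact: rE.1.
  rewrite (_ : _ `&` _ = pt_of @^-1` cube c r); last first.
    by apply/seteqP; split=> [t []//|t Qt]; split=> //; exact: QE.
  by rewrite [X in fine X](cube_volume _ _ (ltW r0))/= exprn_gt0// mulrn_wgt0.
apply: le_Rintegral; [exact: rE.1| |exact: region_integrable|].
  exact: (region_integrable _ _ rE (tameM _ _ _ (tame_cst E e) tQ)).
move=> t Et; rewrite indicE; have [|_] := boolP (_ \in _).
  by rewrite inE => /cube_sub[_]; rewrite mulr1.
by rewrite mulr0 f0.
Qed.

End VolumeIntegral.

(** * Elements, faces and prisms over faces as bounded measurable sets *)

Section MeshRegions.
Context {R : realType} {d : nat}.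
Local Notation pt := 'rV[R]_d.
Implicit Types (K : cell R d) (E : set pt) (nu : pt).

Lemma region_sub (E E' : set pt) : measurable (pt_of @^-1` E) -> E `<=` E' ->
  (exists M, forall x, E' x -> forall i, `|x ord0 i| <= M) -> region E.
Proof.
move=> mE EE' [M ME']; split=> // i; split; first exact: pt_measurable_coord.
by exists M => x /EE'/ME'.
Qed.

Lemma pt_measurable_dot nu : pt_measurable (dot nu).
(* On the empty set boundedness is vacuous, so [tame_dot] yields measurability alone. *)
Proof. by have [] : tame set0 (fun x : pt => dot nu x); [apply: tame_dot => i; split; [exact: pt_measurable_coord|exists 0]|]. Qed.

Lemma pt_measurable_cst (c : R) : pt_measurable (fun _ : pt => c).
Proof. exact: measurable_cst. Qed.

Lemma cell_open_measurable K : measurable (pt_of @^-1` cell_open K).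
Proof.
by apply: measurable_forall => i; apply: measurable_lt; [exact: pt_measurable_dot|exact: pt_measurable_cst].
Qed.

Lemma cell_closed_measurable K : measurable (pt_of @^-1` cell_closed K).
Proof.
by apply: measurable_forall => i; apply: measurable_le; [exact: pt_measurable_dot|exact: pt_measurable_cst].
Qed.

Lemma face_measurable K (i : 'I_(nface K)) : measurable (pt_of @^-1` face i).
Proof.
rewrite (_ : face i = cell_closed K `&` [set x | offset i <= dot (normal i) x]).
  rewrite preimage_setI; apply: measurableI; first exact: cell_closed_measurable.
  by apply: measurable_le; [exact: pt_measurable_cst|exact: pt_measurable_dot].
apply/seteqP; split=> x [Kx] /=; first by move=> <-; split.
by move=> xi; split=> //; apply/eqP; rewrite eq_le xi Kx.
Qed.

Lemma cell_open_closed K : cell_open K `<=` cell_closed K.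
Proof. by move=> x Kx i; exact/ltW/Kx. Qed.

Lemma is_cell_bounded K : is_cell K ->
  exists M, forall x, cell_closed K x -> forall i, `|x ord0 i| <= M.
Proof.
move=> [_ _ _ [M [_ MK]]]; exists (M + 1) => x Kx i.
have := MK (M + 1); rewrite ltrDl ltr01 => /(_ isT x Kx); apply: le_trans.
rewrite [leRHS]/Num.norm/= mx_normrE.
exact: (@le_bigmax _ _ _ 0 (fun ij => `|x ij.1 ij.2|) (ord0, i)).
Qed.

Lemma cell_open_nbhs K (x : pt) : cell_open K x -> nbhs x (cell_open K).
Proof.
move=> Kx; apply: (@filter_forall _ _ (fun i y => dot (normal i) y < offset i) (nbhs x)) => i.
by exact: (@cvgr_lt _ _ _ _ (dot (normal i)) _ (dot_continuous (normal i) x) _ (Kx i)).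
Qed.

(** This prism is the domain of integration in [surf_int]. Each of its points is its foot in [E]
    plus a multiple in [0, 1] of [nu], hence bounded. *)
Lemma flat_prism_region nu c E : measurable (pt_of @^-1` E) ->
  (exists M, forall x, E x -> forall i, `|x ord0 i| <= M) ->
  let foot x := x - (dot nu x - c) *: nu in
  region [set x | 0 <= dot nu x - c <= 1 /\ E (foot x)].
Proof.
move=> mE [M ME] foot.
have mh : pt_measurable (fun x => dot nu x - c).
  by apply: measurable_funB; [exact: pt_measurable_dot|exact: pt_measurable_cst].
apply: (@region_sub _ [set x | 0 <= dot nu x - c <= 1 /\ E (foot x)]) => //.
  rewrite (_ : [set x | _] = [set x | 0 <= dot nu x - c] `&`
      [set x | dot nu x - c <= 1] `&` foot @^-1` E).
    rewrite !preimage_setI; apply: measurableI; first apply: measurableI.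
    - exact: measurable_le (pt_measurable_cst 0) mh.
    - exact: measurable_le mh (pt_measurable_cst 1).
    - apply: measurable_preimage_pt => // i.
      rewrite (_ : (fun _ => _) = fun x : pt => x ord0 i - (dot nu x - c) * nu ord0 i); last first.
        by apply/funext => x; rewrite !mxE.
      apply: measurable_funB; first exact: pt_measurable_coord.
      by apply: measurable_funM => //; exact: pt_measurable_cst.
  by apply/seteqP; split=> x /=; [move=> [/andP[]]|move=> [[-> ->]]].
exists (M + \sum_i `|nu ord0 i|) => x [/andP[h0 h1] /ME Ex] i.
have -> : x ord0 i = foot x ord0 i + (dot nu x - c) * nu ord0 i by rewrite !mxE subrK.
apply: (le_trans (ler_normD _ _)); apply: lerD => //.
rewrite normrM ger0_norm// (bigD1 i)//=.
apply: (@le_trans _ _ `|nu ord0 i|); first by rewrite ler_piMl.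
by rewrite lerDl sumr_ge0.
Qed.

End MeshRegions.

(** * The discontinuous Galerkin forms *)

Section PiecewiseBasis.
Context {R : realType} {d N : nat}.
Variable k : nat.
Local Notation pw := {ffun 'I_N -> mpoly.mpoly d R}.

(** Monomials supported on one element. The bound in [bmultinom] is strict, so [k.+1] gives the
    degrees up to [k], in accordance with [msize] at most [k.+1] in [Vh]. *)
Definition pw_basis (i : 'I_N * mpoly.bmultinom d k.+1) : pw :=
  [ffun L => if L == i.1 then mpoly.mpolyX R i.2 else 0].

Lemma pw_basis_sumE (x : 'I_N * mpoly.bmultinom d k.+1 -> R) L :
  (\sum_i x i *: pw_basis i) L = \sum_m x (L, m) *: mpoly.mpolyX R (mpoly.bmnm m).
Proof.
rewrite sum_ffunE (eq_bigr (fun i : _ * _ => (x (i.1, i.2) *: pw_basis (i.1, i.2)) L)); last by case.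
rewrite -(pair_bigA _ (fun K m => (x (K, m) *: pw_basis (K, m)) L))/= (bigD1 L)//=.
rewrite [X in _ + X]big1 ?addr0 => [|K KL].
  by apply: eq_bigr => m _; rewrite !ffunE/= eqxx.
by apply: big1 => m _; rewrite !ffunE/= eq_sym (negPf KL) scaler0.
Qed.

Lemma pw_basis_free x : \sum_i x i *: pw_basis i = 0 -> forall i, x i = 0.
Proof.
move=> x0 [L m]; have := congr1 (fun v : pw => mpoly.mcoeff m (v L)) x0.
rewrite pw_basis_sumE ffunE mpoly.mcoeff0 raddf_sum/= (bigD1 m)//= big1 => [|m' m'm].
  by rewrite addr0 mpoly.mcoeffZ mpoly.mcoeffX eqxx mulr1.
by rewrite mpoly.mcoeffZ mpoly.mcoeffX -mpoly.bmeqP (negPf m'm) mulr0.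
Qed.

Lemma Vh_span (v : pw) : Vh k v <-> exists x, v = \sum_i x i *: pw_basis i.
Proof.
split=> [Vv|[x ->] K].
  exists (fun i : 'I_N * mpoly.bmultinom d k.+1 => mpoly.mcoeff i.2 (v i.1)); apply/ffunP => L.
  by rewrite pw_basis_sumE/= -mpoly.mpolywE//; exact: Vv.
rewrite pw_basis_sumE (leq_trans (mpoly.msize_sum _ _ _))//.
apply/bigmax_leqP => m _; rewrite (leq_trans (mpoly.msizeZ_le _ _))//.
by rewrite mpoly.msizeX; exact: mpoly.bmdeg.
Qed.

Lemma Vh_linear x (u v : pw) : Vh k u -> Vh k v -> Vh k (x *: u + v).
Proof.
move=> /Vh_span[y ->] /Vh_span[z ->]; apply/Vh_span; exists (fun i => x * y i + z i).
by rewrite scaler_sumr -big_split; apply: eq_bigr => i _; rewrite scalerDl scalerA.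
Qed.

(** [lax_milgram] for the monomial basis. With the L^2 product it yields [L2proj] and [Lh]; with the
    form of the resolvent it yields [Bh]. *)
Lemma Vh_riesz (c : pw -> pw -> R) (l : pw -> R) :
  (forall w, scalar (c^~ w)) -> (forall w, scalar (c w)) ->
  (forall w, c w w = 0 -> w = 0) -> scalar l ->
  exists v, Vh k v /\ forall w, Vh k w -> c v w = l w.
Proof.
move=> cl cr c0 ll.
have [x xl] := lax_milgram _ _ _ _ _ _ pw_basis_free cl cr c0 ll.
exists (\sum_i x i *: pw_basis i); split; first by apply/Vh_span; exists x.
by move=> w /Vh_span[y ->].
Qed.

End PiecewiseBasis.

Section ScalarForms.
Context {R : realType} {V : lmodType R}.
Implicit Types f g : V -> R.

Lemma scalar_add f g : scalar f -> scalar g -> scalar (fun v => f v + g v).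
Proof. by move=> lf lg x u v; rewrite lf lg mulrDr addrACA. Qed.

Lemma scalar_sum (I : Type) (s : seq I) (P : pred I) (f : I -> V -> R) :
  (forall i, P i -> scalar (f i)) -> scalar (fun v => \sum_(i <- s | P i) f i v).
Proof.
move=> lf x u v; rewrite mulr_sumr -big_split.
by apply: eq_bigr => i Pi; exact: lf.
Qed.

Lemma scalar_if (b : bool) f : scalar f -> scalar (fun v => if b then f v else 0).
Proof. by case: b => // lf x u v; rewrite mulr0 addr0. Qed.

Lemma scalar_mul (c : R) f : scalar f -> scalar (fun v => c * f v).
Proof. by move=> lf x u v; rewrite lf mulrDr mulrCA. Qed.

End ScalarForms.

(** * Bilinearity, symmetry and definiteness of the forms *)

Section DiscreteForms.
Context {R : realType} {d N : nat}.
Variables (Omega : set 'rV[R]_d) (T : 'I_N -> cell R d).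
Hypothesis hT : is_mesh Omega T.
Local Notation pt := 'rV[R]_d.
Local Notation pw := {ffun 'I_N -> mpoly.mpoly d R}.

Lemma pev_scalar (x : pt) : scalar (fun p : mpoly.mpoly d R => pev p x).
Proof. by move=> a p q; rewrite /pev mpoly.mevalD mpoly.mevalZ. Qed.

Lemma dot_grad_scalar (nu x : pt) : scalar (fun p : mpoly.mpoly d R => dot nu (grad p x)).
Proof.
apply: scalar_sum => i _; apply: scalar_mul => a p q.
by rewrite !mxE mpoly.mderivD mpoly.mderivZ pev_scalar.
Qed.

Lemma scalar_ffun (K : 'I_N) (f : mpoly.mpoly d R -> R) :
  scalar f -> scalar (fun v : pw => f (v K)).
Proof. by move=> lf a u v; rewrite !ffunE lf. Qed.

Lemma fn_scalar x : scalar (fun v : pw => fn T v x).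
Proof. by apply: scalar_sum => K _; apply/scalar_mul/scalar_ffun/pev_scalar. Qed.

(** Since [fn] vanishes outside [U], pairings with discrete functions only see this finite union of
    open polytopes, which is a [region]. *)
Let U : set pt := \bigcup_K cell_open (T K).

Lemma cells_region : region U.
Proof.
have [cellT _ _ _] := hT.
have [M TM] := choice (fun K => is_cell_bounded _ (cellT K)).
apply: (@region_sub _ _ _ (\bigcup_K cell_closed (T K))).
- rewrite /U preimage_bigcup; apply: fin_bigcup_measurable => // K _.
  exact: cell_open_measurable.
- by move=> x [K _ /cell_open_closed Kx]; exists K.
- exists (\sum_K `|M K|) => x [K _ Kx] i; apply: (le_trans (TM K x Kx i)).
  by rewrite (le_trans (ler_norm _))// (bigD1 K)//= lerDl sumr_ge0.
Qed.

Lemma region_coord E i : region E -> tame E (fun x : pt => x ord0 i).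
Proof. by move=> [_]; exact. Qed.

Lemma fn_tame E (v : pw) : region E -> tame E (fn T v).
Proof.
move=> rE; apply: tame_sum => K; apply: tameM.
  by apply: tame_indic; exact: cell_open_measurable.
by apply: (tame_pev _ _ id) => i; exact: region_coord.
Qed.

Lemma fn_support (v : pw) x : ~ U x -> fn T v x = 0.
Proof.
move=> Ux; rewrite /fn big1// => K _; rewrite indicE memNset ?mul0r//.
by move=> Kx; apply: Ux; exists K.
Qed.

Lemma fnE (v : pw) K x : cell_open (T K) x -> fn T v x = pev (v K) x.
Proof.
move=> Kx; have [_ _ dT _] := hT.
rewrite /fn (bigD1 K)//= indicE mem_set// mul1r big1 ?addr0// => L LK.
rewrite indicE memNset ?mul0r// => Lx.
suff : set0 x by [].
by rewrite -(dT L K LK).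
Qed.

Lemma L2ipE f v : L2ip Omega f (fn T v) = vol_int U (fun x => f x * fn T v x).
Proof.
have [_ TO _ _] := hT.
apply: vol_int_support => [x [K _ /TO]//|x /fn_support ->]; exact: mulr0.
Qed.

Lemma L2ipC f g : L2ip Omega f g = L2ip Omega g f.
Proof. by apply: eq_vol_int => x _; rewrite mulrC. Qed.

Lemma L2ip_scalar f : tame U f -> scalar (fun v => L2ip Omega f (fn T v)).
Proof.
move=> tf a u v; rewrite !L2ipE; apply: vol_int_linear.
- exact: cells_region.
- by apply: tameM => //; apply: fn_tame; exact: cells_region.
- by apply: tameM => //; apply: fn_tame; exact: cells_region.
- by move=> x _; rewrite fn_scalar mulrDr mulrCA.
Qed.

Lemma L2ip_fn_scalar v : scalar (fun w => L2ip Omega (fn T v) (fn T w)).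
Proof. by apply: L2ip_scalar; apply: fn_tame; exact: cells_region. Qed.

Lemma L2ip_ge0 v : 0 <= L2ip Omega (fn T v) (fn T v).
Proof. by apply: vol_int_ge0 => x _; rewrite -expr2 sqr_ge0. Qed.

(** If [v K] were nonzero at a point of the open element [K], its square would stay above half of
    that value nearby and the integral would be positive. So [v K] vanishes on a cube inside [K] and
    is the zero polynomial. *)
Lemma L2ip_eq0 v : L2ip Omega (fn T v) (fn T v) = 0 -> v = 0.
Proof.
move=> v0; apply/ffunP => K; rewrite ffunE.
have [cellT _ _ _] := hT; have [_ _ [c Kc] _] := cellT K.
have /nbhs_cube[r r0 QK] := cell_open_nbhs _ _ Kc.
apply: (mpoly_eq0_box _ _ _ (fun i => c ord0 i) r r0) => y yc.
pose x : pt := \row_i y i.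
have <- : pev (v K) x = mpoly.meval y (v K) by apply: mpoly.meval_eq => i; rewrite mxE.
have Kx : cell_open (T K) x.
  by apply: QK => i; rewrite mxE /ball/= distrC; exact: yc.
apply/eqP/negPn/negP => vx.
suff : 0 < L2ip Omega (fn T v) (fn T v) by rewrite v0 ltxx.
have e0 : 0 < pev (v K) x ^+ 2 by rewrite exprn_even_gt0.
rewrite L2ipE; apply: (@vol_int_gt0 _ _ _ _ x (pev (v K) x ^+ 2 / 2)).
- exact: cells_region.
- by apply: tameM; apply: fn_tame; exact: cells_region.
- by move=> z _; rewrite -expr2 sqr_ge0.
- by rewrite divr_gt0.
have ltx : pev (v K) x ^+ 2 / 2 < (fun z => pev (v K) z * pev (v K) z) x.
  by rewrite /= -expr2 ltr_pdivrMr// ltr_pMr// ltr1n.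
have cont : {for x, continuous (fun z => pev (v K) z * pev (v K) z)}.
  by apply: continuousM; exact: pev_continuous.
have Kge : \forall z \near x, pev (v K) x ^+ 2 / 2 <= pev (v K) z * pev (v K) z.
  exact: (cvgr_ge _ cont _ ltx).
apply: filterS2 (cell_open_nbhs _ _ Kx) Kge => z Kz ez; split; first by exists K.
by rewrite (fnE _ _ _ Kz).
Qed.

(** The integrand is polynomial in the coordinates of the foot point, which are tame on the prism,
    so [vol_int_linear] applies. *)
Lemma face_int_scalar nu c E t K1 K2 (v : pw) : measurable (pt_of @^-1` E) ->
  (exists M, forall x, E x -> forall i, `|x ord0 i| <= M) ->
  scalar (fun w : pw => face_int nu c E t K1 K2 w v).
Proof.
move=> mE bE a w1 w2; have rQ := flat_prism_region nu c _ mE bE.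
rewrite /face_int /surf_int; set foot := fun x : pt => x - (dot nu x - c) *: nu.
set Q := [set x | _] in rQ *.
have tfoot i : tame Q (fun x => foot x ord0 i).
  under eq_fun do rewrite !mxE.
  apply: tameB; first exact: region_coord.
  apply: tameM; last exact: tame_cst.
  apply: tameB; last exact: tame_cst.
  by apply: (tame_dot _ _ id) => j; exact: region_coord.
have tfoott i : tame Q (fun x => (foot x + t) ord0 i).
  by under eq_fun do rewrite mxE; apply: tameD => //; exact: tame_cst.
have tjump (p : pw) : tame Q (fun x => pev (p K2) (foot x + t) - pev (p K1) (foot x)).
  by apply: tameB; exact: tame_pev.
have tavg (p : pw) : tame Q (fun x =>
    2^-1 * (dot nu (grad (p K1) (foot x)) + dot nu (grad (p K2) (foot x + t)))).
  apply: tameM; first exact: tame_cst.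
  by apply: tameD; apply: tame_dot => i; exact: tame_grad.
apply: vol_int_linear => //.
- by apply: tameD; apply: tameM; [exact: tavg|exact: tjump|exact: tjump|exact: tavg].
- by apply: tameD; apply: tameM; [exact: tavg|exact: tjump|exact: tjump|exact: tavg].
move=> x _ /=; rewrite !ffunE !dot_grad_scalar !pev_scalar; ring.
Qed.

Lemma face_intC nu c E t K1 K2 (w v : pw) :
  face_int nu c E t K1 K2 w v = face_int nu c E t K1 K2 v w.
Proof. by apply: eq_vol_int => x _ /=; rewrite addrC mulrC [X in _ + X]mulrC. Qed.

Lemma face_bounded K (i : 'I_(nface (T K))) :
  exists M, forall x, face i x -> forall j, `|x ord0 j| <= M.
Proof.
have [cellT _ _ _] := hT; have [M KM] := is_cell_bounded _ (cellT K).
by exists M => x [/KM].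
Qed.

Lemma dgA_scalar bc a v : scalar (fun w => dgA Omega T bc a w v).
Proof.
have [cellT _ _ _] := hT.
apply: scalar_add; first apply: scalar_add.
- apply: scalar_sum => K _ x u w.
  have rK : region (cell_open (T K)).
    apply: (@region_sub _ _ _ (cell_closed (T K))); last exact: is_cell_bounded.
      exact: cell_open_measurable.
    exact: cell_open_closed.
  have tp p : tame (cell_open (T K)) (fun y => pev p y).
    by apply: (tame_pev _ _ id) => i; exact: region_coord.
  have tg p i : tame (cell_open (T K)) (fun y => grad p y ord0 i).
    by apply: (tame_grad _ _ id) => j; exact: region_coord.
  have tI (p q : mpoly.mpoly d R) : tame (cell_open (T K)) (fun y =>
      dot (grad p y) (grad q y) - a / 2 * pev p y * pev q y).
    apply: tameB; first by apply: tame_sum => i; exact: tameM.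
    by do 2!apply: tameM => //; exact: tame_cst.
  apply: vol_int_linear => // y _; rewrite !ffunE !pev_scalar.
  (* [dot_grad_scalar] is linearity in the second factor, so the gradients are swapped first. *)
  have dotC (p q : pt) : dot p q = dot q p.
    by apply: eq_bigr => i _; rewrite mulrC.
  rewrite !(dotC _ (grad (v K) y)) dot_grad_scalar; ring.
- apply: scalar_sum => K1 _; apply: scalar_sum => K2 _; apply: scalar_sum => i _ /=.
  apply/scalar_if/face_int_scalar.
    rewrite preimage_setI; apply: measurableI; first exact: face_measurable.
    exact: cell_closed_measurable.
  by have [M FM] := face_bounded _ i; exists M => x [/FM].
case: bc => [t|] /=; last by move=> x u w; rewrite mulr0 addr0.
apply: scalar_mul; apply: scalar_sum => K1 _; apply: scalar_sum => i _.
apply: scalar_sum => K2 _ /=; apply/scalar_if/face_int_scalar.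
  rewrite (_ : [set x | _] = face i `&` (fun x => x + t (normal i)) @^-1` cell_closed (T K2))//.
  rewrite preimage_setI; apply: measurableI; first exact: face_measurable.
  apply: measurable_preimage_pt; last exact: cell_closed_measurable.
  move=> j; rewrite (_ : (fun _ => _) = fun x : pt => x ord0 j + t (normal i) ord0 j).
    by apply: measurable_funD; [exact: pt_measurable_coord|exact: pt_measurable_cst].
  by apply/funext => x; rewrite mxE.
by have [M FM] := face_bounded _ i; exists M => x [/FM].
Qed.

Lemma dgAC bc a w v : dgA Omega T bc a w v = dgA Omega T bc a v w.
Proof.
rewrite /dgA /dgA0; apply: (congr2 +%R); first apply: (congr2 +%R).
- apply: eq_bigr => K _; apply: eq_vol_int => x _; congr (_ - _).
    by apply: eq_bigr => i _; rewrite mulrC.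
  by rewrite mulrAC.
- apply: eq_bigr => K1 _; apply: eq_bigr => K2 _; apply: eq_bigr => i _ /=.
  by rewrite face_intC.
case: bc => [t|]; last exact: erefl.
apply: (congr1 ( *%R _)).
apply: eq_bigr => K1 _; apply: eq_bigr => i _; apply: eq_bigr => K2 _ /=.
by rewrite face_intC.
Qed.

End DiscreteForms.

(** * Existence of the projection, of [Lh] and of [Bh] *)

Section DiscreteOperators.
Context {R : realType} {d N : nat}.
Variables (Omega : set 'rV[R]_d) (T : 'I_N -> cell R d) (k : nat).
Variables (bc : bcond R d) (a : R).
Hypothesis hT : is_mesh Omega T.
Local Notation pw := {ffun 'I_N -> mpoly.mpoly d R}.
Local Notation ip u v := (L2ip Omega (fn T u) (fn T v)).
Local Notation A := (dgA Omega T bc a).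
Local Notation L := (Lh Omega T k bc a).

Let ipC (u v : pw) : ip u v = ip v u. Proof. exact: L2ipC. Qed.
Let ip_lin (u : pw) : scalar (fun v => ip u v). Proof. exact: L2ip_fn_scalar. Qed.
Let ip_linl (u : pw) : scalar (fun v => ip v u).
Proof. by move=> x v w; rewrite !(L2ipC _ _ (fn T u)) ip_lin. Qed.

(** [xget] returns its default 0 only if the defining set is empty; a Riesz representative shows
    that it is not. The next two lemmas follow the same pattern. *)
Lemma L2projP (f : 'rV[R]_d -> R) : tame (\bigcup_K cell_open (T K)) f ->
  Vh k (L2proj Omega T k f) /\
  forall w, Vh k w -> ip (L2proj Omega T k f) w = L2ip Omega f (fn T w).
Proof.
move=> tf; apply: (@xgetPex _ 0 [set p | Vh k p /\ forall w, Vh k w -> ip p w = L2ip Omega f (fn T w)]).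
by apply: Vh_riesz => //; [exact: L2ip_eq0|exact: L2ip_scalar].
Qed.

Lemma LhP (v : pw) : Vh k (L v) /\ forall w, Vh k w -> ip (L v) w = A v w.
Proof.
apply: (@xgetPex _ 0 [set w | Vh k w /\ forall psi, Vh k psi -> ip w psi = A v psi]).
apply: Vh_riesz => //; first exact: L2ip_eq0.
by move=> x u w; rewrite !(dgAC _ _ _ _ v) dgA_scalar.
Qed.

Lemma BhP (tau : R) (f : pw) : 0 <= tau -> Vh k f ->
  Vh k (Bh Omega T k bc a tau f) /\
  Bh Omega T k bc a tau f + tau *: L (L (Bh Omega T k bc a tau f)) = f.
Proof.
move=> tau0 Vf; apply: (@xgetPex _ 0 [set v | Vh k v /\ v + tau *: L (L v) = f]).
exact: (@resolvent_ex _ _ (Vh k) (fun u v => ip u v) A L (@Vh_linear R d N k) ipC ip_lin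
  (L2ip_ge0 Omega T) (L2ip_eq0 _ _ hT) (dgA_scalar _ _ hT bc a) (dgAC _ _ bc a)
  (fun v => (LhP v).1) (fun v => (LhP v).2) tau f
  (fun c cl cr c0 => Vh_riesz _ c _ cl cr c0 (ip_lin f)) tau0 Vf).
Qed.

End DiscreteOperators.

(** The square root does not depend on the point, so only Phi' on the bounded range of [f] has to be
    controlled. *)
Lemma sav_b_tame (R : realType) d (Omega E : set 'rV[R]_d) (Phi : R -> R) B f :
  continuous (derive1 Phi) -> tame E f -> tame E (sav_b Omega Phi B f).
Proof.
move=> cPhi tf; apply: tameM; last exact: tame_cst.
exact: (tame_continuous _ _ _ cPhi tf).
Qed.

Theorem theorem4p2 (R : realType) (d : nat) (hd : (0 < d)%N)
  (Omega : set 'rV[R]_d) (hOmega : convex_bounded_domain Omega)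
  (N : nat) (T : 'I_N -> cell R d) (hT : is_mesh Omega T)
  (sigma : R) (hsigma : shape_regular sigma T)
  (k : nat) (bc : bcond R d) (hbc : bcond_ok Omega T bc) (a : R)
  (Phi : R -> R) (hPhi : forall x, derivable Phi x 1)
  (hdPhi : continuous (derive1 Phi))
  (B : R)
  (hB : forall v : {ffun 'I_N -> mpoly.mpoly d R}, Vh k v ->
          0 < vol_int Omega (Phi \o fn T v) + B)
  (dt : R) (hdt : 0 < dt) (n : nat)
  (un um qn : {ffun 'I_N -> mpoly.mpoly d R}) (rn : R)
  (hun : Vh k un) (hum : Vh k um) (hum0 : n = 0%N -> um = un)
  (hqn : Vh k qn)
  (hqun : forall psi, Vh k psi ->
            L2ip Omega (fn T qn) (fn T psi) = dgA Omega T bc a un psi) :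
  (exists u q r,
     sav_step Omega T k bc a Phi B dt un um qn rn u q r /\
     forall u' q' r',
       sav_step Omega T k bc a Phi B dt un um qn rn u' q' r' ->
       [/\ u' = u, q' = q & r' = r]) /\
  (forall u q r,
     sav_step Omega T k bc a Phi B dt un um qn rn u q r <->
     two_step Omega T k bc a Phi B dt un um qn rn u q r).
Proof.
pose b := sav_b Omega Phi B (fn T (ustar un um)).
pose P := L2proj Omega T k b.
pose ip (u v : {ffun 'I_N -> mpoly.mpoly d R}) := L2ip Omega (fn T u) (fn T v).
pose A := dgA Omega T bc a.
pose L := Lh Omega T k bc a.
pose Bo := Bh Omega T k bc a (dt / 2).
have tb : tame (\bigcup_K cell_open (T K)) b.
  by apply: sav_b_tame => //; apply: fn_tame; exact: (cells_region _ _ hT).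
(* [PE] exchanges b(u^{n,*}) and its projection against any element of V_h; the translation into the
   abstract step rests on it. *)
have [VP PE] : Vh k P /\ forall w, Vh k w -> ip P w = L2ip Omega b (fn T w).
  exact: L2projP.
have dt2 : 0 <= dt / 2 by rewrite divr_ge0// ltW.
have V_lin : forall x (u v : {ffun 'I_N -> mpoly.mpoly d R}), Vh k u -> Vh k v -> Vh k (x *: u + v).
  exact: Vh_linear.
have LP v := LhP Omega T k bc a hT v.
have BP f : Vh k f -> Vh k (Bo f) /\ Bo f + (dt / 2) *: L (L (Bo f)) = f.
  exact: BhP.
have Vdt u : Vh k u -> Vh k (dt^-1 *: (u - un)).
  move=> Vu; apply: (S_scale (Vh k) V_lin).
  by rewrite addrC -scaleN1r; exact: V_lin.
have sysE rh u q : linear_system Omega T k bc a Phi B dt un um qn rh u q <->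
    cn_system (Vh k) ip A dt un qn P rh u q.
  split=> -[E qE]; split=> // w Vw; have := E w Vw.
    by rewrite -(PE w Vw).
  by rewrite (PE w Vw).
have stepE u q r : sav_step Omega T k bc a Phi B dt un um qn rn u q r <->
    cn_step (Vh k) ip A dt un qn P rn u q r.
  split=> -[Vu Vq /sysE sys E]; split=> //; rewrite E; congr (_ * _).
    by rewrite PE//; exact: Vdt.
  by rewrite PE//; exact: Vdt.
(* Membership in V_h is what allows b to be replaced by [P] in the numerator of R^{n,*}. *)
have VBxi : Vh k (Bo (cn_xi ip dt un P rn)).
  apply: (BP _ _).1; rewrite /cn_xi addrC; apply: (Vh_linear) => //.
  by rewrite addrC -scaleNr; exact: V_lin.
have xiE : xi_star Omega T k Phi B dt un um rn = cn_xi ip dt un P rn.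
  by rewrite /cn_xi (PE _ hun); exact: erefl.
have rhE : r_half Omega T k bc a Phi B dt un um rn = cn_rhalf ip Bo dt un P rn.
  by rewrite /r_half /R_star xiE /cn_rhalf (PE _ VBxi); exact: erefl.
have twoE u q r : two_step Omega T k bc a Phi B dt un um qn rn u q r <->
    [/\ Vh k u, Vh k q, r = 2 * cn_rhalf ip Bo dt un P rn - rn &
        cn_system (Vh k) ip A dt un qn P (cn_rhalf ip Bo dt un P rn) u q].
  rewrite /two_step rhE.
  by split=> -[Vu Vq rE sys]; (split; [exact: Vu|exact: Vq|exact: rE|exact/sysE]).
have ip_lin w : scalar (ip w) by exact: L2ip_fn_scalar.
have ip0 v : ip v v = 0 -> v = 0 by exact: L2ip_eq0.
have A_lin w : scalar (A^~ w) by exact: dgA_scalar.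
have ipC u v : ip u v = ip v u by exact: L2ipC.
have AC u v : A u v = A v u by exact: dgAC.
have ip_ge v : 0 <= ip v v by exact: L2ip_ge0.
have [[u [q [r [step uniq]]]] stepP] := cn_realization (Vh k) ip A L
  V_lin ipC ip_lin ip_ge ip0 A_lin AC (fun v => (LP v).1) (fun v => (LP v).2)
  Bo dt un qn P rn (fun f Vf => (BP f Vf).1) (fun f Vf => (BP f Vf).2)
  hdt hun VP hqn hqun.
split=> [|u' q' r'].
  exists u, q, r; split; first exact/stepE.
  by move=> u' q' r' /stepE; exact: uniq.
apply: (iff_trans (stepE u' q' r')); apply: (iff_trans (stepP u' q' r')).
exact: (iff_sym (twoE u' q' r')).
Qed.
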